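(* Let $\beta>0$ be an algebraic number and let $\mathcal{G}$ be a connected simple undirected graph with vertex set $\{1,\dots,n\}$ and adjacency matrix $A$. (1) $[e^{\beta A}]_{ii}=[e^{\beta A}]_{jj}$ for all vertices $i,j$ if and only if $\mathcal{G}$ is walk-regular, i.e. $[A^r]_{ii}=[A^r]_{jj}$ for all vertices $i,j$ and all integers $r>0$. (2) If two vertices $i,j$ satisfy $[e^{\beta A}]_{ii}=[e^{\beta A}]_{jj}$, then $i$ and $j$ have the same degree centrality and the same eigenvector centrality. (3) If $[e^{\beta A}]_{ii}=[e^{\beta A}]_{jj}$ for all vertices $i,j$, then the degree centralities of all vertices are equal and the eigenvector centralities of all vertices are equal.
   Context: A complex number is algebraic if it is a root of a nonzero polynomial with rational coefficients. $e^{\beta A}$ is the matrix exponential. The degree centrality of vertex $i$ is its degree, the number of edges incident to $i$ (equal to $[A^2]_{ii}$). Since $\mathcal{G}$ is connected and undirected, by Perron–Frobenius the eigenvalue $\lambda_1$ of $A$ of largest absolute value is simple and has a unit-norm eigenvector $(q_1,\dots,q_n)^T$ with nonnegative entries; the eigenvector centrality of vertex $i$ is $q_i$. *)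

(* Defs.v *)
From mathcomp Require Import all_boot all_order all_algebra.
From mathcomp Require Import all_classical all_reals all_analysis.

Set Implicit Arguments.
Unset Strict Implicit.
Unset Printing Implicit Defensive.

Import Order.TTheory GRing.Theory Num.Theory.
Import numFieldNormedType.Exports.

Local Open Scope ring_scope.

Definition simple_graph (n : nat) (e : rel 'I_n) : Prop :=
  symmetric e /\ irreflexive e.

Definition connected_graph (n : nat) (e : rel 'I_n) : Prop :=
  forall i j : 'I_n, connect e i j.

Definition edges (n : nat) (e : rel 'I_n) : {set {set 'I_n}} :=
  [set [set p.1; p.2]%SET | p in [pred p : 'I_n * 'I_n | e p.1 p.2]]%SET.

Definition degree_centrality (n : nat) (e : rel 'I_n) (i : 'I_n) : nat :=
  #|[set E in edges e | i \in E]%SET|.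

Definition adjmx (R : realType) (n : nat) (e : rel 'I_n) : 'M[R]_n :=
  \matrix_(i < n, j < n) (e i j)%:R.

(* The limit is taken in the topology of entrywise convergence on matrices. *)
Definition expmx (R : realType) (n : nat) (X : 'M[R]_n) : 'M[R]_n :=
  lim (series (fun k : nat => (k`!%:R : R)^-1 *: X ^+ k) @ \oo)%classic.

Definition algebraic (R : realType) (x : R) : Prop :=
  algebraicOver (ratr : rat -> R) x.

Definition walk_regular (R : realType) (n : nat) (A : 'M[R]_n) : Prop :=
  forall (i j : 'I_n) (r : nat), (0 < r)%N -> (A ^+ r) i i = (A ^+ r) j j.

(* Real eigenvalues suffice, A being meant to be symmetric.  For a bipartite
   graph both lam and - lam have this property; only the nonnegative one can
   have a nonnegative eigenvector. *)
Definition leading_eigenvalue (R : realType) (n : nat) (A : 'M[R]_n)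
    (lam : R) : Prop :=
  eigenvalue A lam /\ (forall mu : R, eigenvalue A mu -> `|mu| <= `|lam|).

(* For the adjacency matrix of a connected graph on at least one vertex, the
   Perron-Frobenius theorem gives exactly one such q; q i 0 is the eigenvector
   centrality of i. *)
Definition eigenvector_centralities (R : realType) (n : nat) (A : 'M[R]_n)
    (q : 'cV[R]_n) : Prop :=
  exists lam : R,
    [/\ leading_eigenvalue A lam,
        A *m q = lam *: q,
        forall i : 'I_n, 0 <= q i 0
      & \sum_(i < n) q i 0 ^+ 2 = 1].

(* Main.v *)
From HB Require Import structures.
Require Import Defs.
From mathcomp Require Import all_boot all_order all_algebra.
From mathcomp Require Import all_classical all_reals all_analysis.
From mathcomp Require Import separable complex ring.

Import Order.TTheory GRing.Theory Num.Theory.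
Import numFieldNormedType.Exports.

Local Open Scope ring_scope.

(** Everything reduces to the claim that equality of the (i,i) and (j,j) entries
    of exp(beta A) forces a_n := [A^n]_ii - [A^n]_jj to vanish for all n. Here a
    is an integer sequence, a power sum of algebraic numbers, and
    sum_n a_n beta^n / n! = 0, so this is a case of Lindemann-Weierstrass.

    To make beta rational, choose a rational matrix B with nonzero determinant
    and separable characteristic polynomial having beta as an eigenvalue, and
    replace F(z) = sum_n a_n z^n / n! by G(z) = det F(zB), the product of the
    F(beta' z) over the eigenvalues beta' of B. Then G(z) = sum_n u_n z^n / n!
    vanishes at z = 1, u_n is rational with denominator dividing D^n, and u is a
    power sum, hence killed by a separable integer polynomial Q. Moreover G <> 0
    unless a = 0, as its lowest coefficient is a power of det B times a power of
    the first nonzero a_r / r!.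

    In the spirit of Beukers, Bezivin and Robba, let U and L be the linear forms
    on polynomials given by U(X^n) = u_n and L(X^n) = sum_(k <= n) n!/k! u_k, so
    L(P) = U(P) + L(P'). As G(1) = 0, L(X^n) is minus the tail of a convergent
    series and grows only exponentially; but L(X^j Q^m) is divisible by m! up to
    powers of D. Hence L kills the multiples of Q^m for m large, and by the
    relation L(P) = U(P) + L(P') all polynomials. So U = 0.

    The degree is [A^2]_ii, and the squared eigenvector centrality q_i^2 is a
    fixed multiple of [g(A)]_ii for a polynomial g, the leading eigenvalue being
    simple. *)

(** * The vanishing criterion *)

(** The terms [K ^+ m / m!] of the exponential series tend to 0; the threshold [1 / (|E| + 1)] makes
    sense for every [E], zero included. *)
Lemma geometric_lt_fact (R : realType) (E K : R) :
  exists M : nat, forall m, (M <= m)%N -> E * K ^+ m < m`!%:R.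
Proof.
have /cvgrPdist_lt/(_ ((`|E| + 1)^-1)) [] := @cvg_exp_coeff R K.
  by rewrite invr_gt0 ltr_wpDl.
move=> M _ MP; exists M => m /MP /=.
rewrite sub0r normrN /exp_coeff /= normrM normfV normr_nat.
rewrite -[_^-1 in X in _ < X]mul1r ltr_pdivlMr ?ltr_wpDl//.
rewrite mulrAC ltr_pdivrMr ?ltr0n ?fact_gt0// mul1r => lt_m.
apply: le_lt_trans lt_m; rewrite mulrC (le_trans (ler_norm _))// normrM.
by rewrite ler_wpM2l// lerDl.
Qed.

Section MomentFunctional.
Context {R : fieldType}.
Implicit Types (u : nat -> R) (p q : {poly R}).

(** The form U of the overview, for any sequence [u]; L is [moment (laplace u)]. *)
Definition moment u p : R := \sum_(k < size p) p`_k * u k.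

Lemma moment_wide u p n : (size p <= n)%N ->
  moment u p = \sum_(k < n) p`_k * u k.
Proof.
move=> le_n; rewrite /moment (big_ord_widen _ (fun k => p`_k * u k) le_n).
rewrite big_mkcond; apply: eq_bigr => k _; case: ltnP => // le_k.
by rewrite nth_default ?mul0r.
Qed.

Lemma moment_is_linear u : linear_for *%R (moment u).
Proof.
move=> a p q; pose n := maxn (size (a *: p + q)) (maxn (size p) (size q)).
rewrite !(moment_wide _ _ n) ?leq_max ?leqnn ?orbT// mulr_sumr -big_split/=.
by apply: eq_bigr => k _; rewrite coefD coefZ mulrDl mulrA.
Qed.

HB.instance Definition _ u :=
  GRing.isLinear.Build R {poly R} R *%R (moment u) (moment_is_linear u).

Lemma momentZ u a p : moment u (a *: p) = a * moment u p.
Proof. by have := moment_is_linear u a p 0; rewrite raddf0 !addr0. Qed.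

Lemma momentXn u n : moment u 'X^n = u n.
Proof.
rewrite /moment size_polyXn big_ord_recr/= big1 => [|k _].
  by rewrite coefXn eqxx mul1r add0r.
by rewrite coefXn ltn_eqF ?mul0r.
Qed.

(* If [u n] is the sum of the [c i * z i ^+ n], then [laplace u n] is the sum of
   the [c i] times the integral of [(t + z i)^n exp(-t)] over [t >= 0]. *)
Definition laplace u n : R := \sum_(k < n.+1) (n`!%:R / k`!%:R) * u k.

Hypothesis R0 : [pchar R] =i pred0.

Let fact_neq0 n : n`!%:R != 0 :> R.
Proof. by rewrite ((pcharf0P R).1 R0) -lt0n fact_gt0. Qed.

Lemma laplaceS u n : laplace u n.+1 = u n.+1 + n.+1%:R * laplace u n.
Proof.
rewrite /laplace big_ord_recr/= divff// mul1r addrC; congr (_ + _).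
rewrite mulr_sumr; apply: eq_bigr => k _.
by rewrite factS natrM !mulrA.
Qed.

(** On monomials this is the recursion [laplaceS]; for the integral it is integration by parts
    against exp(-t). *)
Lemma moment_laplace_deriv u p :
  moment (laplace u) p = moment u p + moment (laplace u) p^`().
Proof.
have sz : (size p <= (size p).+1)%N by [].
rewrite !(moment_wide _ _ _ sz).
have sz' : (size p^`() <= size p)%N.
  by rewrite (leq_trans (size_poly _ _))// leq_pred.
rewrite (moment_wide _ _ _ sz') !big_ord_recl -addrA.
congr (_ + _).
  by rewrite /laplace big_ord1 divff// mul1r.
rewrite -big_split/=; apply: eq_bigr => k _.
rewrite /bump/= add1n laplaceS coef_deriv.
by rewrite -[_ *+ _]mulr_natr; ring.
Qed.

Lemma moment_laplace_derivn u p n :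
  moment (laplace u) p =
    \sum_(k < n) moment u p^`(k) + moment (laplace u) p^`(n).
Proof.
elim: n => [|n IHn]; first by rewrite big_ord0 add0r.
by rewrite IHn big_ord_recr -addrA; congr (_ + _); exact: moment_laplace_deriv.
Qed.

End MomentFunctional.

(** Each derivation removes at most one factor [q], so one is left after [k < m] of them. *)
Lemma dvdp_exp_derivn (R : fieldType) (q p : {poly R}) m k : (k < m)%N ->
  q ^+ m %| p -> q %| p^`(k).
Proof.
elim: k m p => [|k IHk] [|m]// p km; first by apply: dvdp_trans;
  rewrite exprS dvdp_mulr.
move=> /dvdpP [r ->]; rewrite derivSn; apply: (IHk m) => //.
rewrite derivM deriv_exp/= dvdp_add//; first by rewrite exprS mulrCA !dvdp_mull.
by rewrite dvdp_mull// -mulr_natr dvdp_mulr// dvdp_mull.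
Qed.

Lemma polyOver_intM (R : archiNumDomainType) (p q : {poly R}) :
  p \is a polyOver Num.int -> q \is a polyOver Num.int ->
  p * q \is a polyOver Num.int.
Proof.
move=> /polyOverP p_int /polyOverP q_int; apply/polyOverP => i.
by rewrite coefM rpred_sum// => k _; rewrite rpredM.
Qed.

Lemma polyOver_intX (R : archiNumDomainType) (p : {poly R}) n :
  p \is a polyOver Num.int -> p ^+ n \is a polyOver Num.int.
Proof.
move=> p_int; elim: n => [|n IHn]; last by rewrite exprS polyOver_intM.
by rewrite expr0; apply/polyOverP => i; rewrite coef1 natr_int.
Qed.

Section Vanishing.
Variables (R : realType) (u : nat -> R) (Q : {poly R}) (D : nat) (C : R).
Hypothesis D_gt0 : (0 < D)%N.
Hypothesis u_int : forall n, D%:R ^+ n * u n \is a Num.int.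
Hypothesis Q_int : Q \is a polyOver Num.int.
Hypothesis Q_sep : coprimep Q Q^`().
Hypothesis uQ : forall p : {poly R}, moment u (p * Q) = 0.
Hypothesis v_le : forall n, `|laplace u n| <= C ^+ n.+1.

Let R0 : [pchar R] =i pred0. Proof. exact: pchar_num. Qed.
Local Notation L := (moment (laplace u)).
Let C_ge0 : 0 <= C.
Proof. by have := v_le 0; rewrite expr1; apply: le_trans. Qed.

Let moment_int p s : p \is a polyOver Num.int -> (size p <= s.+1)%N ->
  D%:R ^+ s * moment u p \is a Num.int.
Proof.
move=> /polyOverP p_int le_s; rewrite (moment_wide _ _ _ le_s) mulr_sumr.
apply: rpred_sum => -[k /= lt_k] _.
rewrite mulrCA rpredM//.
rewrite -(subnK (_ : k <= s)%N) ?exprD -?mulrA; last by rewrite -ltnS.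
by rewrite rpredM// rpredX// natr_int.
Qed.

(** L(P) is the sum of the U(P^(k)). For k < m the polynomial P^(k) is still a multiple of [Q], so
    its term vanishes. For k >= m it is k! times an integral polynomial, and m! divides k!. *)
Let L_dvd p m s : p \is a polyOver Num.int -> (size p <= s.+1)%N ->
  Q ^+ m %| p -> exists2 z, z \is a Num.int & D%:R ^+ s * L p = m`!%:R * z.
Proof.
move=> p_int le_s dvd_p.
rewrite (moment_laplace_derivn R0 _ _ (m + size p)).
have -> : p^`(m + size p) = 0.
  apply/eqP; rewrite -size_poly_eq0 -leqn0.
  have : forall k (q : {poly R}), (size q <= k)%N -> q^`(k) = 0.
    elim=> [|k IHk] q; first by rewrite leqn0 size_poly_eq0 => /eqP->.
    move=> le_q; rewrite derivSn IHk// (leq_trans (size_poly _ _))//.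
    by case: (size q) le_q.
  by move->; rewrite ?size_poly0// leq_addl.
rewrite raddf0 addr0 big_split_ord/= big1 => [|k _]; last first.
  have /dvdpP [r ->] : Q %| p^`(k) by apply: dvdp_exp_derivn dvd_p.
  exact: uQ.
exists (\sum_(i < size p) (((m + i)`! %/ m`!)%N%:R * (D%:R ^+ s *
   moment u p^`N(m + i)))).
  apply: rpred_sum => i _; rewrite rpredM ?natr_int//.
  apply: moment_int; first exact: polyOver_nderivn.
  by apply: leq_trans le_s; rewrite (leq_trans (size_poly _ _))// leq_subr.
rewrite add0r !mulr_sumr; apply: eq_bigr => i _.
rewrite [RHS]mulrA -natrM mulnC divnK; last first.
  by rewrite -(bin_fact (leq_addr i m)) dvdn_mull// dvdn_mulr.
by rewrite nderivn_def raddfMn/= -mulr_natr; ring.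
Qed.

(** The value at [C] of [Q] with coefficients replaced by their absolute values: each further factor
    [Q] costs at most a factor [K] in the bound on L. *)
Let K := \sum_(k < size Q) `|Q`_k| * C ^+ k.
Let K_ge0 : 0 <= K.
Proof. by apply: sumr_ge0 => k _; rewrite mulr_ge0 ?exprn_ge0. Qed.

Let L_le m n : `|L ('X^n * Q ^+ m)| <= K ^+ m * C ^+ n.+1.
Proof.
elim: m n => [|m IHm] n; first by rewrite expr0 mulr1 mul1r momentXn.
have -> : 'X^n * Q ^+ m.+1 = \sum_(k < size Q) Q`_k *: ('X^(n + k) * Q ^+ m).
  rewrite exprS -{1}(coefK Q) poly_def mulr_suml mulr_sumr.
  by apply: eq_bigr => k _; rewrite -scalerAl -scalerAr mulrA exprD.
rewrite raddf_sum (le_trans (ler_norm_sum _ _ _))//.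
rewrite exprS mulr_suml mulr_suml ler_sum// => k _.
rewrite /= momentZ normrM -!mulrA ler_wpM2l//.
rewrite (le_trans (IHm _))// mulrCA -exprD addnC.
by rewrite addnS.
Qed.

Let d := (size Q).-1.

(* [L ('X^j * Q ^+ m)] grows at most exponentially in [m] but, up to an
   exponential denominator, it is an integer multiple of [m`!]. *)
Let L_small : exists M, forall m j, (M <= m)%N -> (j <= d)%N ->
  L ('X^j * Q ^+ m) = 0.
Proof.
(* With [1 <= c] the bound [c ^+ d.+1] serves all [j <= d] at once. *)
pose c := Num.max C 1.
have [M MP] := geometric_lt_fact _ (D%:R ^+ d * c ^+ d.+1) (D%:R ^+ d * K).
exists M => m j le_m le_j.
have int_p : 'X^j * Q ^+ m \is a polyOver Num.int.
  by apply: polyOver_intM; [exact: polyOverXn | exact: polyOver_intX].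
have sz_p : (size ('X^j * Q ^+ m)%R <= (d + d * m).+1)%N.
  rewrite (leq_trans (size_polyMleq _ _))// size_polyXn addSn/=.
  rewrite -addnS leq_add// (leq_trans (size_poly_exp_leq _ _))//.
have [z z_int Dz] := L_dvd _ m _ int_p sz_p (dvdp_mull _ (dvdpp _)).
have Dn0 s : (D%:R : R) ^+ s != 0 by rewrite expf_neq0// pnatr_eq0 -lt0n.
have z0 : z = 0.
  apply/eqP; rewrite -[_ == 0]negbK; apply/negP => z_neq0.
  have z_ge1 : 1 <= `|z| by rewrite norm_intr_ge1.
  have /MP : (M <= m)%N by [].
  apply/negP; rewrite -leNgt.
  apply: (@le_trans _ _ (m`!%:R * `|z|)); first by rewrite ler_peMr.
  have -> : m`!%:R * `|z| = `|D%:R ^+ (d + d * m) * L ('X^j * Q ^+ m)|.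
    by rewrite Dz normrM normr_nat.
  rewrite normrM normrX normr_nat exprMn exprD exprM -!mulrA.
  rewrite ler_wpM2l ?exprn_ge0// [X in _ <= X]mulrCA ler_wpM2l ?exprn_ge0//.
  rewrite (le_trans (L_le _ _))// mulrC ler_wpM2r ?exprn_ge0//.
  have c1 : 1 <= c by rewrite le_max lexx orbT.
  apply: (@le_trans _ _ (c ^+ j.+1)); last by rewrite ler_weXn2l.
  apply: lerXn2r; rewrite ?nnegrE// ?(le_trans ler01 c1)//.
  by rewrite /c le_max lexx.
by move/eqP: Dz; rewrite z0 mulr0 mulf_eq0 (negPf (Dn0 _)) => /eqP.
Qed.

(** Repeated division by [Q] trades the degree of [p] for higher powers of [Q], until [L_small]
    applies to the remainders. *)
Let L_ideal : exists M, forall p : {poly R}, L (p * Q ^+ M) = 0.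
Proof.
have [M MP] := L_small; exists M => p.
have low m (q : {poly R}) :
  (M <= m)%N -> (size q <= d.+1)%N -> L (q * Q ^+ m) = 0.
  move=> le_m le_q; rewrite -{1}(coefK q) poly_def mulr_suml raddf_sum.
  apply: big1 => k _; rewrite -scalerAl /= momentZ MP ?mulr0//.
  by rewrite -ltnS (leq_trans (ltn_ord k)).
(* Division by a constant does not lower the degree, but if [Q] is constant then U = 0, so L(P) =
   L(P') and repeated derivation kills L. *)
have [Q_small|Q_big] := leqP (size Q) 1.
  have Q_neq0 : Q != 0.
    by apply: contraTneq Q_sep => ->;
      rewrite deriv0 coprimep0 -size_poly_eq1 size_poly0.
  have /size_poly1P [c c0 Qc] :
    size Q == 1 by rewrite eqn_leq Q_small size_poly_gt0.
  have u0 (q : {poly R}) : moment u q = 0.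
    have := uQ (c^-1 *: q).
    by rewrite Qc mulrC mul_polyC scalerA divff// scale1r.
  have L0 : forall n (q : {poly R}), (size q <= n)%N -> L q = 0.
    elim=> [|n IHn] q; first by rewrite leqn0 size_poly_eq0 => /eqP->;
      rewrite raddf0.
    move=> le_q; rewrite (moment_laplace_deriv R0) u0 add0r; apply: IHn.
    by rewrite (leq_trans (size_poly _ _))//; case: (size q) le_q.
  exact: (L0 _ _ (leqnn _)).
have : forall n (q : {poly R}) m, (size q <= n)%N -> (M <= m)%N -> L (q * Q ^+
  m) = 0.
  elim=> [|n IHn] q m le_q le_m.
    by apply: low => //; apply: leq_trans le_q _.
  rewrite [q](divp_eq q Q) mulrDl raddfD/=.
  rewrite -mulrA -exprS IHn ?(leq_trans le_m)// ?low ?addr0//.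
    by rewrite /d prednK ?(ltnW Q_big)// ltnW// ltn_modp -size_poly_gt0 (ltnW
      Q_big).
  rewrite size_divp -?size_poly_gt0 ?(ltnW Q_big)//.
  by move: le_q Q_big; case: (size Q) => [|[|s]]// => le_q _ /=;
    rewrite leq_subLR addSn
    (leq_trans le_q)// ltnS leq_addl.
by apply.
Qed.

(* By Bezout for [Q] and [Q'], integration by parts ([moment_laplace_deriv])
   lowers the power of [Q] whose multiples are annihilated by [L]. *)
Let L_eq0 (p : {poly R}) : L p = 0.
Proof.
have [M] := L_ideal.
elim: M p => [|m IHm] p LM; first by have := LM p; rewrite expr0 mulr1.
apply: IHm => r; have /Bezout_eq1_coprimepP [[a b] /= ab1] := Q_sep.
(* Integrate [q * Q ^+ m.+1] by parts: U and L both vanish on this polynomial, and so does L on the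
   part of its derivative that keeps [Q ^+ m.+1]. *)
have LQ' (q : {poly R}) : L (q * Q^`() * Q ^+ m) = 0.
  have := moment_laplace_deriv R0 u (q * Q ^+ m.+1).
  rewrite LM {1}exprSr mulrA uQ add0r derivM deriv_exp/= raddfD/= LM add0r.
  move=> /esym/eqP.
  have -> : q * (Q^`() * Q ^+ m *+ m.+1) = m.+1%:R *: (q * Q^`() * Q ^+ m).
    by rewrite -mul_polyC polyC_natr -mulr_natr; ring.
  by rewrite momentZ mulf_eq0 pnatr_eq0 => /eqP.
have -> : r * Q ^+ m = (r * a) * Q ^+ m.+1 + (r * b) * Q^`() * Q ^+ m.
  by rewrite -[r in LHS]mulr1 -ab1 exprS; ring.
by rewrite raddfD/= LM LQ' addr0.
Qed.

Lemma laplace_bounded_eq0 n : u n = 0.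
Proof.
rewrite -(momentXn u n).
by have := moment_laplace_deriv R0 u 'X^n; rewrite !L_eq0 addr0 => /esym.
Qed.

End Vanishing.

(** * Power series *)

(** The wrapper makes room for the Cauchy product, as opposed to pointwise multiplication on
    [nat -> R]. *)
Record pser (R : Type) := PSer { pcoef : nat -> R }.
Arguments PSer {R} pcoef.
Arguments pcoef {R} p n.

HB.instance Definition _ (R : Type) := gen_eqMixin (pser R).
HB.instance Definition _ (R : Type) := gen_choiceMixin (pser R).

Section PowerSeries.
Context {R : comNzRingType}.
Implicit Types f g h : pser R.

Lemma pserP f g : (forall n, pcoef f n = pcoef g n) -> f = g.
Proof. by case: f g => [f] [g] /= /funext ->. Qed.

Definition pser_const (c : R) :
  pser R := PSer (fun n => if n is 0 then c else 0).
Definition pser_add f g : pser R := PSer (fun n => pcoef f n + pcoef g n).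
Definition pser_opp f : pser R := PSer (fun n => - pcoef f n).
Definition pser_mul f g : pser R :=
  PSer (fun n => \sum_(i < n.+1) pcoef f i * pcoef g (n - i)).

Fact pser_addA : associative pser_add.
Proof. by move=> f g h; apply: pserP => n; apply: addrA. Qed.
Fact pser_addC : commutative pser_add.
Proof. by move=> f g; apply: pserP => n; apply: addrC. Qed.
Fact pser_add0 : left_id (pser_const 0) pser_add.
Proof. by move=> f; apply: pserP => -[|n]; apply: add0r. Qed.
Fact pser_addN : left_inverse (pser_const 0) pser_opp pser_add.
Proof. by move=> f; apply: pserP => -[|n]; apply: addNr. Qed.

HB.instance Definition _ :=
  GRing.isZmodule.Build (pser R) pser_addA pser_addC pser_add0 pser_addN.

(** Coefficient [n] of a product depends only on truncations beyond degree [n], so commutativity and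
    associativity come from polynomials. *)
Let trunc N f : {poly R} := \poly_(i < N) pcoef f i.

Let coef_trunc N f i : (i < N)%N -> (trunc N f)`_i = pcoef f i.
Proof. by move=> ltiN; rewrite coef_poly ltiN. Qed.

Let pcoef_mul_trunc N f g n : (n < N)%N ->
  pcoef (pser_mul f g) n = (trunc N f * trunc N g)`_n.
Proof.
move=> ltnN; rewrite coefM; apply: eq_bigr => -[i /= lein] _.
by rewrite !coef_trunc// ?(leq_ltn_trans _ ltnN)// leq_subr.
Qed.

Fact pser_mulC : commutative pser_mul.
Proof.
by move=> f g; apply: pserP => n;
  rewrite !(pcoef_mul_trunc n.+1 _ _ n (ltnSn n)) mulrC.
Qed.

Fact pser_mulA : associative pser_mul.
Proof.
suff assoc f g h n : pcoef (pser_mul (pser_mul f g) h) n =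
    (trunc n.+1 f * trunc n.+1 g * trunc n.+1 h)`_n.
  move=> f g h; apply: pserP => n; rewrite pser_mulC !assoc.
  by rewrite mulrC mulrA.
rewrite coefM; apply: eq_bigr => -[i /= lein] _.
rewrite -(pcoef_mul_trunc n.+1)// coef_trunc//.
by rewrite ltnS leq_subr.
Qed.

Fact pser_mul_const c f n : pcoef (pser_mul (pser_const c) f) n = c * pcoef f n.
Proof.
rewrite /= big_ord_recl/= subn0 big1 ?addr0// => i _.
by rewrite mul0r.
Qed.

Fact pser_mul1 : left_id (pser_const 1) pser_mul.
Proof. by move=> f; apply: pserP => n; rewrite pser_mul_const mul1r. Qed.

Fact pser_mulDl : left_distributive pser_mul pser_add.
Proof.
move=> f g h; apply: pserP => n /=; rewrite -big_split/=.
by apply: eq_bigr => i _; rewrite mulrDl.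
Qed.

Fact pser_1neq0 : pser_const 1 != pser_const 0.
Proof. by apply/eqP => /(congr1 (pcoef ^~ 0))/eqP; rewrite /= oner_eq0. Qed.

HB.instance Definition _ := GRing.Zmodule_isComNzRing.Build (pser R)
  pser_mulA pser_mulC pser_mul1 pser_mulDl pser_1neq0.

Lemma pcoefM f g n :
  pcoef (f * g) n = \sum_(i < n.+1) pcoef f i * pcoef g (n - i).
Proof. by []. Qed.

Lemma pcoef_sum (I : Type) (r : seq I) (P : pred I) (F : I -> pser R) n :
  pcoef (\sum_(i <- r | P i) F i) n = \sum_(i <- r | P i) pcoef (F i) n.
Proof.
by elim/big_rec2: _ => [|i y x _ <-]; first by case: n.
Qed.

Lemma pcoef_constM c f n : pcoef (pser_const c * f) n = c * pcoef f n.
Proof. exact: pser_mul_const. Qed.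

Definition pser0 f : R := pcoef f 0.

Fact pser0_is_zmod_morphism : zmod_morphism pser0.
Proof. by []. Qed.
Fact pser0_is_monoid_morphism : monoid_morphism pser0.
Proof. by split=> // f g; rewrite /pser0 pcoefM big_ord1. Qed.

HB.instance Definition _ :=
  GRing.isZmodMorphism.Build (pser R) R pser0 pser0_is_zmod_morphism.
HB.instance Definition _ :=
  GRing.isMonoidMorphism.Build (pser R) R pser0 pser0_is_monoid_morphism.

Definition pserX : pser R := PSer (fun n => (n == 1)%:R).

Lemma pcoefXM f n : pcoef (pserX * f) n = if n is m.+1 then pcoef f m else 0.
Proof.
rewrite pcoefM; case: n => [|n]; first by rewrite big_ord1/= mul0r.
rewrite !big_ord_recl/= mul0r add0r mul1r subSS subn0 big1 ?addr0// => i _.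
by rewrite mul0r.
Qed.

Lemma pcoefXnM f r n :
  pcoef (pserX ^+ r * f) n = if (n < r)%N then 0 else pcoef f (n - r).
Proof.
elim: r n => [|r IHr] n; first by rewrite mul1r subn0.
by rewrite exprS -mulrA pcoefXM; case: n => [|n]//; rewrite IHr.
Qed.

(** The series of 1/(1 - z); [egf (pser1 * f)] is then [laplace (egf f)]. *)
Definition pser1 : pser R := PSer (fun=> 1).

Lemma pcoef1M f n : pcoef (pser1 * f) n = \sum_(i < n.+1) pcoef f i.
Proof.
rewrite mulrC pcoefM; apply: eq_bigr => i _; exact: mulr1.
Qed.

Definition egf f n : R := n`!%:R * pcoef f n.

Lemma egf1 n : egf 1 n = (n == 0)%:R.
Proof. by rewrite /egf; case: n => [|n]; rewrite ?mulr0 ?mulr1. Qed.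

Lemma egfB f g n : egf (f - g) n = egf f n - egf g n.
Proof. exact: mulrBr. Qed.

Lemma egfM f g n :
  egf (f * g) n = \sum_(i < n.+1) 'C(n, i)%:R * (egf f i * egf g (n - i)).
Proof.
rewrite /egf pcoefM mulr_sumr; apply: eq_bigr => -[i /= lein] _.
by rewrite -(bin_fact (lein : (i <= n)%N)) !natrM; ring.
Qed.

End PowerSeries.

(** * Integrality and growth as subring properties *)

Section SubringPredicate.
Context {R : comNzRingType}.

(** Serves to pass properties of power series from the entries of a matrix to its determinant and
    adjugate. *)
Record subring_prop (P : R -> Prop) : Prop := SubringProp {
  subring_prop1 : P 1;
  subring_propB : forall x y, P x -> P y -> P (x - y);
  subring_propM : forall x y, P x -> P y -> P (x * y) }.

Variable P : R -> Prop.
Hypothesis PP : subring_prop P.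

Let P0 : P 0.
Proof. by rewrite -(subrr 1); apply: (subring_propB _ PP);
  apply: (subring_prop1 _ PP). Qed.
Let PN x : P x -> P (- x).
Proof. by move=> Px; rewrite -sub0r; apply: (subring_propB _ PP). Qed.
Let PD x y : P x -> P y -> P (x + y).
Proof. by move=> Px Py; rewrite -[y]opprK; apply: (subring_propB _ PP) => //;
  apply: PN. Qed.

Lemma subring_prop_sum (I : finType) (F : I -> R) :
  (forall i, P (F i)) -> P (\sum_i F i).
Proof. by move=> PF; apply: big_ind => //. Qed.

Lemma subring_prop_sign n : P ((-1) ^+ n).
Proof.
elim: n => [|n IHn]; first exact: (subring_prop1 _ PP).
by rewrite exprS; apply: (subring_propM _ PP) => //; apply: PN;
  apply: (subring_prop1 _ PP).
Qed.

Lemma subring_prop_det n (M : 'M[R]_n) :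
  (forall i j, P (M i j)) -> P (\det M).
Proof.
move=> PM; apply: subring_prop_sum => s.
apply: (subring_propM _ PP); first exact: subring_prop_sign.
apply: big_ind => //; [exact: (subring_prop1 _ PP) | exact:
  (subring_propM _ PP)].
Qed.

Lemma subring_prop_adj n (M : 'M[R]_n) :
  (forall i j, P (M i j)) -> forall i j, P ((\adj M) i j).
Proof.
move=> PM i j; rewrite mxE; apply: (subring_propM _ PP).
  exact: subring_prop_sign.
by apply: subring_prop_det => k l; rewrite !mxE.
Qed.

End SubringPredicate.

Definition egf_integral {R : archiRealFieldType} (f : pser R) :=
  exists2 D, (0 < D)%N & forall n, D%:R ^+ n * egf f n \is a Num.int.

(** The exponent [n.+1] lets [C] absorb the value at [n = 0] and forces [0 <= C]. *)
Definition egf_bounded {R : realFieldType} (f : pser R) :=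
  exists C, forall n, `|egf f n| <= C ^+ n.+1.

Lemma egf_integral_subring (R : archiRealFieldType) :
  subring_prop (@egf_integral R).
Proof.
split.
- by exists 1 => // n; rewrite egf1 rpredM ?rpredX ?natr_int.
- move=> f g [D D_gt0 Df] [E E_gt0 Eg]; exists (D * E)%N;
  first by rewrite muln_gt0 D_gt0.
  move=> n; rewrite egfB natrM exprMn.
  have -> : D%:R ^+ n * E%:R ^+ n * (egf f n - egf g n) =
      E%:R ^+ n * (D%:R ^+ n * egf f n) - D%:R ^+ n * (E%:R ^+ n * egf g n).
    by ring.
  by apply: rpredB; apply: rpredM; rewrite // rpredX ?natr_int.
- move=> f g [D D_gt0 Df] [E E_gt0 Eg]; exists (D * E)%N;
  first by rewrite muln_gt0 D_gt0.
  move=> n; rewrite egfM mulr_sumr rpred_sum// => -[i /= lein] _.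
  rewrite mulrCA natrM exprMn; apply: rpredM; first exact: natr_int.
  have -> : D%:R ^+ n * E%:R ^+ n * (egf f i * egf g (n - i)) =
    D%:R ^+ (n - i) * E%:R ^+ i *
      ((D%:R ^+ i * egf f i) * (E%:R ^+ (n - i) * egf g (n - i))).
    by rewrite -{1 2}(subnK (lein : (i <= n)%N)) !exprD; ring.
  by do 2![apply: rpredM => //]; rewrite rpredX ?natr_int.
Qed.

Lemma egf_bounded_subring (R : realFieldType) :
  subring_prop (@egf_bounded R).
Proof.
have C_ge0 (f : pser R) C : (forall n, `|egf f n| <= C ^+ n.+1) -> 0 <= C.
  by move=> /(_ 0); rewrite expr1; apply: le_trans.
split.
- by exists 1 => n; rewrite egf1 expr1n normr_nat; case: n.
- move=> f g [C Cf] [D Dg]; exists (C + D) => n; rewrite egfB.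
  have [C0 D0] := (C_ge0 _ _ Cf, C_ge0 _ _ Dg).
  rewrite (le_trans (ler_normB _ _))// (le_trans (lerD (Cf n) (Dg n)))//.
  rewrite !exprS mulrDl lerD// ler_wpM2l// lerXn2r ?nnegrE ?addr_ge0//.
    by rewrite lerDl.
  by rewrite lerDr.
(* The binomial theorem bounds the convolution by [C * D * (D + C) ^+ n]; the chosen constant
   dominates both [C * D] and [C + D]. *)
- move=> f g [C Cf] [D Dg]; exists (C * D + (C + D)) => n; rewrite egfM.
  have [C0 D0] := (C_ge0 _ _ Cf, C_ge0 _ _ Dg).
  apply: (@le_trans _ _ (C * D * (D + C) ^+ n)).
    rewrite (le_trans (ler_norm_sum _ _ _))// exprDn mulr_sumr ler_sum// =>
      -[i /= lein] _.
    have -> : C * D * (D ^+ (n - i) * C ^+ i *+ 'C(n, i)) =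
        'C(n, i)%:R * (C ^+ i.+1 * D ^+ (n - i).+1).
      by rewrite -mulr_natr !exprS; ring.
    by rewrite normrM normr_nat normrM ler_wpM2l// ler_pM.
  rewrite [X in _ <= X]exprS ler_pM ?mulr_ge0 ?exprn_ge0 ?addr_ge0//.
    by rewrite lerDl addr_ge0.
  rewrite lerXn2r ?nnegrE ?addr_ge0 ?mulr_ge0//.
  by rewrite addrC lerDr mulr_ge0.
Qed.

(** * Power sums of algebraic numbers *)

Section SeparablePart.
Context {F : fieldType}.
Implicit Types (p q : {poly F}).

Lemma root_separable_part p x : [pchar F] =i pred0 -> p != 0 ->
  root p x -> root (p %/ gcdp p p^`()) x.
Proof.
move=> F0 p_neq0 px; apply: contraLR (px); set h := p %/ _ => hx.
have [m [q]] := multiplicity_XsubC p x; rewrite p_neq0 /= => qx Dp.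
apply: contra qx => _; case: m Dp => [|m] Dp.
  by move: px; rewrite Dp expr0 mulr1.
have Dm : ('X - x%:P) ^+ m.+1 %| p^`().
  apply: dvdp_trans (dvdp_gcdr p p^`()).
  rewrite -(@Gauss_dvdpr _ _ h);
    last by rewrite coprimep_expl// coprimep_sym coprimep_XsubC.
  by rewrite divpK ?dvdp_gcdl// Dp dvdp_mull.
move: Dm; rewrite Dp derivM deriv_exp derivXsubC mul1r/=.
rewrite dvdp_addr; last exact: dvdp_mull.
rewrite mulrnAr -mulrnAl exprS.
rewrite dvdp_mul2r ?expf_neq0 ?polyXsubC_eq0// dvdp_XsubCl.
rewrite -mulr_natr rootM => /orP[]//.
by rewrite -polyC_natr rootC (pcharf0P F).1.
Qed.

End SeparablePart.

Lemma map_mxX (R S : comNzRingType) (f : {rmorphism R -> S}) d (M : 'M[R]_d) n :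
  map_mx f (M ^+ n) = map_mx f M ^+ n.
Proof.
elim: n => [|n IHn]; first exact: map_mx1.
by rewrite !exprS -IHn; apply: map_mxM.
Qed.

Lemma conj_diag_mxX (F : fieldType) d (A P : 'M[F]_d) (e : 'rV_d) n s t :
  P \in unitmx -> A = invmx P *m diag_mx e *m P ->
  (A ^+ n) s t = \sum_k invmx P s k * e 0 k ^+ n * P k t.
Proof.
move=> P_unit DA.
have -> : A ^+ n = invmx P *m diag_mx (\row_k e 0 k ^+ n) *m P.
  elim: n => [|n IHn].
    rewrite expr0 (_ : diag_mx _ = 1%:M) ?mulmx1 ?mulVmx//.
    by apply/matrixP => i j; rewrite !mxE expr0.
  rewrite exprS IHn DA -[LHS]/(_ *m _) !mulmxA mulmxK//.
  rewrite -(mulmxA (invmx P) (diag_mx e)) mulmx_diag;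
    congr (_ *m diag_mx _ *m _).
  by apply/rowP => i; rewrite !mxE exprS.
rewrite mxE; apply: eq_bigr => k _; congr (_ * _).
rewrite mxE (bigD1 k)//= big1 => [|i ik]; last by rewrite !mxE (negPf ik) mulr0.
by rewrite !mxE eqxx addr0 mulr1n.
Qed.

Section PowerSums.
Context {R : realType}.
Local Notation algebraicC := (algebraicOver (ratr : rat -> R[i])).

(* The complexification is only used to split polynomials. *)
Definition power_sum (u : nat -> R) := exists2 s : seq (R[i] * R[i]),
  {in s, forall p, algebraicC p.2} &
  forall n, (u n)%:C%C = \sum_(p <- s) p.1 * p.2 ^+ n.

Lemma power_sumB u v :
  power_sum u -> power_sum v -> power_sum (fun n => u n - v n).
Proof.
move=> [s s_alg Du] [t t_alg Dv]; exists (s ++ [seq (- p.1, p.2) | p <- t]).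
  move=> p; rewrite mem_cat => /orP[/s_alg//|/mapP[q tq ->]].
  exact: (t_alg q tq).
move=> n; rewrite rmorphB/= Du Dv big_cat big_map/= -sumrN; congr (_ + _).
by apply: eq_bigr => p _; rewrite mulNr.
Qed.

Lemma power_sumM u v :
  power_sum u -> power_sum v -> power_sum (fun n => u n * v n).
Proof.
move=> [s s_alg Du] [t t_alg Dv].
exists [seq (p.1 * q.1, p.2 * q.2) | p <- s, q <- t].
  move=> _ /allpairsP[[p q] [/= sp tq ->]]/=.
  exact: algebraic_mul (s_alg p sp) (t_alg q tq).
move=> n; rewrite rmorphM/= Du Dv big_allpairs_dep/= mulr_suml;
  apply: eq_bigr => p _.
by rewrite mulr_sumr; apply: eq_bigr => q _ /=; rewrite exprMn mulrACA.
Qed.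

(** These series are the finite sums of c exp(x z) with x algebraic; multiplying them adds
    exponents. *)
Lemma egf_power_sum_subring :
  subring_prop (fun f : pser R => power_sum (egf f)).
Proof.
split.
- exists [:: (1, 0)].
    by move=> p; rewrite inE => /eqP ->; apply: algebraic0.
  by move=> n; rewrite egf1 big_seq1/= mul1r expr0n; case: n.
- move=> f g f_sum g_sum; have [s s_alg Ds] := power_sumB _ _ f_sum g_sum.
  by exists s => // n; rewrite egfB Ds.
- move=> f g [s s_alg Df] [t t_alg Dg].
  exists [seq (p.1 * q.1, p.2 + q.2) | p <- s, q <- t].
    move=> _ /allpairsP[[p q] [/= sp tq ->]]/=.
    exact: algebraic_add (s_alg p sp) (t_alg q tq).
  move=> n; rewrite egfM big_allpairs_dep/= rmorph_sum/=.
  under eq_bigr => i _ do rewrite rmorphM [X in _ * X]rmorphM rmorph_nat/= Df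
    Dg mulr_suml mulr_sumr.
  rewrite exchange_big/=; apply: eq_bigr => p _.
  under eq_bigr => i _ do rewrite !mulr_sumr.
  rewrite exchange_big/=; apply: eq_bigr => q _.
  rewrite addrC exprDn mulr_sumr; apply: eq_bigr => i _.
  by rewrite -mulr_natr; ring.
Qed.

(** [moment u] of a polynomial is a combination of its values at the bases [p.2]. Take the separable
    part of a rational polynomial vanishing at all of them and clear denominators. *)
Lemma power_sum_annihilator u : power_sum u -> exists Q : {poly R},
  [/\ Q \is a polyOver Num.int, coprimep Q Q^`() &
      forall p : {poly R}, moment u (p * Q) = 0].
Proof.
move=> [s s_alg Du].
have [P P_neq0 Ps] : exists2 P : {poly rat}, P != 0 &
    {in s, forall p, root (map_poly (ratr : rat -> R[i]) P) p.2}.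
  elim: s s_alg {Du} => [|p s IHs] s_alg; first by exists 1; rewrite ?oner_eq0.
  have [|P P0 Ps] := IHs; first by move=> q sq; apply: s_alg;
    rewrite inE sq orbT.
  have [P' P'0 P'p] := s_alg p (mem_head _ _).
  exists (P' * P); first by rewrite mulf_neq0.
  move=> q; rewrite inE => q_in; rewrite rmorphM/= rootM.
  by case/orP: q_in => [/eqP->|/Ps->]; rewrite ?P'p ?orbT.
pose P1 := P %/ gcdp P P^`().
have P1_sep : separable_poly P1 by apply: make_separable.
have P1s : {in s, forall p, root (map_poly (ratr : rat -> R[i]) P1) p.2}.
  move=> p /Ps Pp; rewrite map_divp gcdp_map -deriv_map.
  by apply: root_separable_part; rewrite ?map_poly_eq0//; apply: pchar_num.
have [q [a a_neq0 DP1]] := rat_poly_scale P1.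
pose Q : {poly R} := map_poly intr q.
have DQ : map_poly ratr (a%:~R *: P1) = Q.
  rewrite DP1 scalerA divff ?intr_eq0// scale1r -map_poly_comp.
  by apply: eq_map_poly => z /=; rewrite ratr_int.
exists Q; split.
- by apply/polyOverP => i; rewrite coef_map/= intr_int.
- have : separable_poly Q.
    rewrite -DQ separable_map; move: P1_sep;
      rewrite separable_poly.unlock derivZ.
    by rewrite coprimepZl ?coprimepZr ?intr_eq0.
  by rewrite separable_poly.unlock.
move=> p; apply: (fmorph_inj (real_complex R)); rewrite rmorph0 rmorph_sum/=.
under eq_bigr => k _ do rewrite rmorphM/= Du mulr_sumr.
rewrite exchange_big big_seq big1//= => c sc.
transitivity (c.1 * (map_poly (real_complex R) (p * Q)).[c.2]).
  rewrite horner_coef size_map_poly mulr_sumr; apply: eq_bigr => k _.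
  by rewrite coef_map/= mulrCA.
rewrite rmorphM/= hornerM -DQ -map_poly_comp.
rewrite (_ : map_poly _ (_ *: P1) = map_poly ratr (a%:~R *: P1)); last first.
  by apply: eq_map_poly => z /=; rewrite fmorph_rat.
by rewrite map_polyZ hornerZ (rootP (P1s _ sc)) !mulr0.
Qed.

Lemma egf_power_sum_eq0 (f : pser R) : egf_integral f -> power_sum (egf f) ->
  egf_bounded (pser1 * f) -> f = 0.
Proof.
move=> [D D_gt0 Df] f_sum [C Cf].
have [Q [Q_int Q_sep Qf]] := power_sum_annihilator _ f_sum.
apply: pserP => n; rewrite (_ : pcoef 0 n = 0); last by case: n.
have laplaceE k : laplace (egf f) k = egf (pser1 * f) k.
  rewrite /laplace /egf pcoef1M mulr_sumr; apply: eq_bigr => i _.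
  by rewrite mulrA divfK// pnatr_eq0 -lt0n fact_gt0.
have /eqP : egf f n = 0.
  apply: (laplace_bounded_eq0 _ _ Q D C) => // k.
  by rewrite laplaceE.
by rewrite mulf_eq0 pnatr_eq0 -leqn0 leqNgt fact_gt0 => /eqP.
Qed.

(** The bases are the eigenvalues, algebraic as roots of the rational polynomial [char_poly M]. *)
Lemma power_sum_mx d (M : 'M[rat]_d) (P : 'M[R[i]]_d) (e : 'rV[R[i]]_d) s t :
    P \in unitmx ->
    map_mx ratr M = invmx P *m diag_mx e *m P ->
  power_sum (fun n => (map_mx ratr M ^+ n) s t).
Proof.
move=> P_unit DM.
exists [seq (invmx P s k * P k t, e 0 k) | k <- enum 'I_d].
  move=> _ /mapP[k _ ->] /=.
  exists (char_poly M); first by rewrite monic_neq0 ?char_poly_monic.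
  rewrite map_char_poly -eigenvalue_root_char; apply/eigenvalueP.
  exists (row k P).
    rewrite DM -mulmxA -row_mul !mulmxA mulmxV// mul1mx.
    by rewrite row_mul row_diag_mx -scalemxAl -rowE.
  apply/eqP => Pk0; have := congr1 (row k) (mulmxV P_unit).
  rewrite row_mul Pk0 mul0mx => /rowP/(_ k)/eqP.
  by rewrite !mxE eqxx eq_sym oner_eq0.
move=> n; rewrite big_map big_enum/=.
have -> : ((map_mx ratr M ^+ n) s t)%:C%C =
    (map_mx (real_complex R) (map_mx ratr M ^+ n)) s t by rewrite mxE.
rewrite map_mxX -map_mx_comp (_ : map_mx _ M = map_mx ratr M); last first.
  by apply/matrixP => i j; rewrite !mxE /= fmorph_rat.
rewrite (conj_diag_mxX _ _ _ _ _ _ _ _ P_unit DM).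
by apply: eq_bigr => k _; rewrite mulrAC.
Qed.

End PowerSums.

(** The minimal polynomial divides the characteristic one, which splits with distinct roots. *)
Lemma separable_char_poly_diag (F : closedFieldType) d (A : 'M[F]_d.+1) :
  separable_poly (char_poly A) ->
  exists P : 'M[F]_d.+1, exists2 e : 'rV[F]_d.+1,
    P \in unitmx & A = invmx P *m diag_mx e *m P.
Proof.
move=> A_sep; have [rs Drs] := closed_field_poly_normal (char_poly A).
rewrite (monicP (char_poly_monic A)) scale1r in Drs.
suff [P P_unit] : diagonalizable A.
  move=> /diagonalizable_forPex[e /(simmxLR P_unit) DA].
  by exists P, e => //; rewrite DA mxpoly.conjVmx.
apply/diagonalizableP; exists rs.
  by rewrite -separable_prod_XsubC -Drs.
by rewrite -Drs mxminpoly_dvd_char.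
Qed.

(** * Matrix powers and algebraic numbers as eigenvalues *)

Lemma common_denominator (I : finType) (F : I -> rat) :
  exists2 D, (0 < D)%N & forall i, D%:R * F i \is a Num.int.
Proof.
exists (\prod_i `|denq (F i)|)%N.
  by apply: prodn_gt0 => i; rewrite absz_gt0 denq_neq0.
move=> i; rewrite (bigD1 i)//= natrM natr_absz gtr0_norm ?denq_gt0//.
by rewrite mulrAC [_ * F i]mulrC -numqE rpredM ?intr_int ?natr_int.
Qed.

Lemma mx_exprSE (R : pzRingType) d (A : 'M[R]_d) n s t :
  (A ^+ n.+1) s t = \sum_j A s j * (A ^+ n) j t.
Proof. by rewrite exprS -[_ * _]/(_ *m _) mxE. Qed.

Section MatrixPowers.
Context {R : realType}.

Lemma mx_pow_bounded d (B : 'M[R]_d) :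
  exists K, forall n s t, `|(B ^+ n) s t| <= K ^+ n.
Proof.
exists (\sum_s \sum_t `|B s t|); elim=> [|n IHn] s t.
  by rewrite expr0 mxE; case: eqP => _; rewrite ?normr1 ?normr0.
rewrite mx_exprSE (le_trans (ler_norm_sum _ _ _))//.
apply: (@le_trans _ _ (\sum_j `|B s j| * (\sum_s \sum_t `|B s t|) ^+ n)).
  by apply: ler_sum => j _; rewrite normrM ler_wpM2l.
rewrite exprS -mulr_suml ler_wpM2r//.
  by rewrite exprn_ge0//; do 2![apply: sumr_ge0 => ? _].
by rewrite [leRHS](bigD1 s)//= lerDl; do 2![apply: sumr_ge0 => ? _].
Qed.

Lemma mx_pow_integral d (B : 'M[rat]_d) : exists2 D, (0 < D)%N &
  forall n s t, D%:R ^+ n * (map_mx (ratr : rat -> R) B ^+ n) s t \is a Num.int.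
Proof.
have [D D_gt0 DB] := common_denominator _ (fun i : 'I_d * 'I_d => B i.1 i.2).
exists D => //; elim=> [|n IHn] s t.
  by rewrite expr0 mul1r mxE natr_int.
rewrite mx_exprSE mulr_sumr rpred_sum// => j _.
rewrite exprS mulrACA; apply: rpredM => //; rewrite mxE.
have /intrP[z Dz] := DB (s, j).
rewrite -(ratr_nat R D) -rmorphM/= Dz ratr_int intr_int//.
Qed.

(** [B] is a companion matrix. Its polynomial comes from a rational polynomial with root [b] by
    dividing out the powers of 'X, for invertibility, and then taking the monic separable part. *)
Lemma algebraic_eigenvalue (b : R) : algebraic b -> b != 0 ->
  exists d, exists B : 'M[rat]_d.+1, exists w : 'rV[R]_d.+1,
  [/\ w != 0, w *m map_mx ratr B = b *: w,
      map_mx (ratr : rat -> R) B \in unitmx &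
      separable_poly (char_poly B)].
Proof.
move=> [P P_neq0 Pb] b_neq0.
have [q [q_neq0 qb q0]] : exists q : {poly rat},
    [/\ q != 0, root (map_poly (ratr : rat -> R) q) b & ~~ root q 0].
  have [m [q]] := multiplicity_XsubC P 0; rewrite P_neq0 /= => q0 DP.
  exists q; split=> //; first by apply: contraNneq q0 => ->; rewrite root0.
  move: Pb; rewrite DP subr0 rmorphM/= rmorphXn/= map_polyX rootM.
  by case/orP=> //; rewrite rootE hornerXn expf_eq0 (negPf b_neq0) andbF.
pose h := q %/ gcdp q q^`().
have hb : root (map_poly (ratr : rat -> R) h) b.
  rewrite map_divp gcdp_map -deriv_map.
  by apply: root_separable_part; rewrite ?map_poly_eq0//; apply: pchar_num.
have h_sep : separable_poly h := make_separable q_neq0.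
have h0 : ~~ root h 0.
  by apply: contra q0 => h0; rewrite -(divpK (dvdp_gcdl q q^`())) rootM h0.
have h_neq0 : h != 0 by apply: contraNneq h0 => ->; rewrite root0.
have lc_neq0 : (lead_coef h)^-1 != 0 by rewrite invr_eq0 lead_coef_eq0.
pose p := (lead_coef h)^-1 *: h.
have p_monic : p \is monic by rewrite monicE lead_coefZ mulVf ?lead_coef_eq0.
have p_sep : separable_poly p.
  move: h_sep; rewrite separable_poly.unlock derivZ.
  by rewrite coprimepZl ?coprimepZr.
have pb : root (map_poly (ratr : rat -> R) p) b.
  by rewrite map_polyZ rootZ// fmorph_eq0.
have p0 : ~~ root p 0 by rewrite rootZ.
have [B DB] : exists B : 'M[rat]_((size p).-1), char_poly B = p.
  by exists (companionmx p); apply: companionmxK.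
have p_gt1 : (1 < size p)%N.
  rewrite ltnNge; apply/negP => /size1_polyC Dp.
  move: pb p0; rewrite Dp map_polyC !rootC fmorph_eq0 => ->.
  by [].
move: p_gt1 B DB; case: (size p) => [|[|d]]// _ B DB.
have : eigenvalue (map_mx (ratr : rat -> R) B) b.
  by rewrite eigenvalue_root_char -map_char_poly DB.
move=> /eigenvalueP[w wB w_neq0].
exists d, B, w; split=> //; last by rewrite DB.
rewrite map_unitmx unitmxE unitfE; apply: contraNneq p0 => detB.
by rewrite -DB rootE horner_coef0 char_poly_det detB mulr0.
Qed.

End MatrixPowers.

(** * From algebraic to rational argument by a determinant *)

Section ZeroSeries.
Context {R : realType}.

Definition pser_of_egf (u : nat -> R) : pser R :=
  PSer (fun n => u n / n`!%:R).

Lemma fact_neq0 n : n`!%:R != 0 :> R.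
Proof. by rewrite pnatr_eq0 -lt0n fact_gt0. Qed.

Lemma pser_of_egfK u n : egf (pser_of_egf u) n = u n.
Proof. by rewrite /egf /= mulrCA divff ?mulr1// fact_neq0. Qed.

Lemma egf_bounded_const (c : R) : egf_bounded (pser_const c).
Proof.
by exists `|c| => -[|n]; rewrite /egf/= ?fact0 ?mul1r// mulr0 normr0 exprn_ge0.
Qed.

(* The exponential generating function of [a] evaluated at [z *: B]; its
   determinant is the product of the series in [b * z], [b] ranging over the
   eigenvalues of [B]. *)
Definition egf_mx d (a : nat -> R) (B : 'M[R]_d) : 'M[pser R]_d :=
  \matrix_(s, t) pser_of_egf (fun n => a n * (B ^+ n) s t).

(** With [m] the first index where [a] is nonzero, the matrix is [pserX ^+ m *: N], and the constant
    term of [N] is a nonzero multiple of the invertible [B ^+ m]. *)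
Lemma det_egf_mx_neq0 d (a : nat -> R) (B : 'M[R]_d) r :
  B \in unitmx -> a r != 0 -> \det (egf_mx d a B) != 0.
Proof.
move=> B_unit ar.
have [m am m_min] := ex_minnP (ex_intro (fun k => a k != 0) r ar).
have a0 k : (k < m)%N -> a k = 0.
  by move=> km; apply/eqP; apply: contraTT km => /m_min; rewrite -leqNgt.
pose N : 'M[pser R]_d := \matrix_(s, t)
  PSer (fun n => a (n + m)%N * (B ^+ (n + m)) s t / (n + m)`!%:R).
have -> : egf_mx d a B = pserX ^+ m *: N.
  apply/matrixP => s t; rewrite !mxE; apply: pserP => n.
  rewrite pcoefXnM /=; case: ltnP => [/a0 ->|mn]; first by rewrite !mul0r.
  by rewrite subnK.
rewrite detZ -exprM; apply/eqP => /(congr1 (fun f => pcoef f (m * d))).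
rewrite pcoefXnM ltnn subnn -[pcoef _ 0]/(pser0 (\det N)) -det_map_mx.
have -> : map_mx pser0 N = (a m / m`!%:R) *: B ^+ m.
  by apply/matrixP => s t; rewrite !mxE /pser0/= add0n mulrAC.
move/eqP; rewrite -[pcoef 0 _]/(_ _) detZ.
have detX : \det (B ^+ m) = \det B ^+ m.
  elim: (m) => [|k IHk]; first exact: det1.
  by rewrite !exprS -IHk -det_mulmx.
rewrite detX; case: (m * d)%N => [|k] /=;
  rewrite mulf_eq0 !expf_eq0 mulf_eq0 (negPf am) invr_eq0 (negPf (fact_neq0 _));
  by rewrite andbF/= -[_ == 0]negbK -unitfE -unitmxE B_unit andbF.
Qed.

(** The last hypothesis encodes that the sum of the [a n * b ^+ n / n!] is 0: it makes the partial
    sums O(C^n / n!). It passes to the determinant of [egf_mx] through a left eigenvector of [B] for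
    [b], and [egf_power_sum_eq0] then contradicts [det_egf_mx_neq0]. *)
Lemma power_sum_egf_eq0 (a : nat -> R) (b : R) :
    algebraic b -> b != 0 ->
    (forall n, a n \is a Num.int) -> (exists C, forall n, `|a n| <= C ^+ n.+1)
      ->
    power_sum a ->
    egf_bounded (pser1 * pser_of_egf (fun n => a n * b ^+ n)) ->
  forall n, a n = 0.
Proof.
move=> b_alg b_neq0 a_int [C aC] a_sum Fb n.
have [d [B0 [w [w_neq0 wB B_unit B_sep]]]] := algebraic_eigenvalue b b_alg
  b_neq0.
set B := map_mx (ratr : rat -> R) B0 in wB B_unit.
apply/eqP; apply: contraT => /(det_egf_mx_neq0 _ _ _ _ B_unit).
set M := egf_mx _ a B.
have egfM k s t : egf (M s t) k = a k * (B ^+ k) s t.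
  by rewrite mxE pser_of_egfK.
have M_int s t : egf_integral (M s t).
  have [D D_gt0 DB] := @mx_pow_integral R _ B0.
  exists D => // k; rewrite egfM mulrCA.
  by apply: rpredM; [exact: a_int | exact: DB].
have M_bnd s t : egf_bounded (M s t).
  have [K BK] := mx_pow_bounded _ B.
  have C0 : 0 <= C by have := aC 0; rewrite expr1; apply: le_trans.
  have K0 : 0 <= K by have := BK 1 s t; rewrite expr1; apply: le_trans.
  exists (C * (K + 1)) => k; rewrite egfM normrM exprMn ler_pM//.
  rewrite (le_trans (BK k s t))// exprS -[leLHS]mul1r ler_pM ?exprn_ge0//.
    by rewrite lerDr.
  by rewrite lerXn2r ?nnegrE ?addr_ge0// lerDl.
have M_sum s t : power_sum (egf (M s t)).
  have B_sepC : separable_poly (char_poly (map_mx (ratr : rat -> R[i]) B0)).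
    by rewrite -map_char_poly separable_map.
  have [P [e P_unit DB]] := separable_char_poly_diag _ _ _ B_sepC.
  have [l l_alg Dl] := power_sumM _ _ a_sum (power_sum_mx _ B0 P e s t P_unit
    DB).
  by exists l => // k; rewrite egfM Dl.
pose F := pser_of_egf (fun n => a n * b ^+ n).
pose wc := map_mx (@pser_const R) w.
have wM : wc *m M = F *: wc.
  apply/rowP => t; rewrite !mxE; apply: pserP => k.
  rewrite pcoef_sum [F * _]mulrC pcoef_constM.
  transitivity (a k / k`!%:R * (w *m B ^+ k) 0 t).
    rewrite [(w *m _) _ _]mxE mulr_sumr; apply: eq_bigr => s _.
    by rewrite !mxE pcoef_constM/=; ring.
  have -> : w *m B ^+ k = b ^+ k *: w.
    elim: (k) => [|j IHj]; first by rewrite expr0 scale1r; apply: mulmx1.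
    by rewrite [B ^+ _]exprS mulmxA wB -scalemxAl IHj scalerA -exprS.
  by rewrite mxE /F/=; ring.
have [t wt] : exists t, w 0 t != 0 by apply/rV0Pn.
suff -> : \det M = 0 by rewrite eqxx.
apply: egf_power_sum_eq0.
- exact: (subring_prop_det _ (egf_integral_subring R) _ _ M_int).
- exact: (subring_prop_det _ (@egf_power_sum_subring R) _ _ M_sum).
(* From [w M = F w] follows [det M * w = F * w * adj M], and [pser1 * F] is
   bounded. *)
have -> : pser1 * \det M = pser_const (w 0 t)^-1 * ((pser1 * F) * (wc *m \adj
  M) 0 t).
  have : F * (wc *m \adj M) 0 t = pser_const (w 0 t) * \det M.
    have := congr1 (fun v => (v *m \adj M) 0 t) wM.
    rewrite -mulmxA mul_mx_adj mul_mx_scalar -scalemxAl.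
    by rewrite [in LHS]mxE [in RHS]mxE [wc _ _]mxE mulrC => ->.
  move=> E; rewrite -(mulrA pser1) E; apply: pserP => k.
  rewrite pcoef_constM mulrCA pcoef_constM mulKf//.
have bndM := subring_propM _ (@egf_bounded_subring R).
apply: (bndM); first exact: egf_bounded_const.
apply: (bndM) => //; rewrite mxE.
apply: (subring_prop_sum _ (@egf_bounded_subring R)) => s; apply: (bndM).
  by rewrite mxE; apply: egf_bounded_const.
exact: (subring_prop_adj _ (@egf_bounded_subring R) _ _ M_bnd).
Qed.

End ZeroSeries.

(** * The matrix exponential *)

Section ExponentialEntries.
Context {R : realType}.
Local Open Scope classical_set_scope.

Lemma mx_cvg_entrywise n (S : nat -> 'M[R]_n) (L : 'M[R]_n) :
  (forall i j, (fun N => S N i j) @ \oo --> L i j) -> S @ \oo --> L.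
Proof.
move=> SL; apply/cvg_mx_entourageP => U entU.
apply: filter_forall => i; apply: filter_forall => j.
have /cvg_app_entourageP/(_ U entU) := SL i j.
by apply: filterS => N; exact: mem_set.
Qed.

Lemma series_mxE n (F : nat -> 'M[R]_n) N i j :
  series F N i j = series (fun k => F k i j) N.
Proof. by rewrite /series/= summxE. Qed.

(** [expmx] is a [lim], meaningful only once convergence is known. Each entry is dominated by the
    exponential series at [|K|], where [K ^+ k] bounds the entries of [X ^+ k]. *)
Lemma expmx_entry n (X : 'M[R]_n) i j :
  series (fun k => (k`!%:R)^-1 * (X ^+ k) i j) @ \oo --> expmx X i j.
Proof.
set S := series (fun k => (k`!%:R : R)^-1 *: X ^+ k).
have SE s t : (fun N => S N s t) =
    series (fun k => (k`!%:R)^-1 * (X ^+ k) s t).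
  apply/funext => N; rewrite /S series_mxE; congr (series _ N).
  by apply/funext => k; rewrite mxE.
have [K XK] := mx_pow_bounded _ X.
have entry_cvg s t : cvgn (series (fun k => (k`!%:R)^-1 * (X ^+ k) s t)).
  apply: normed_cvg; apply: (@series_le_cvg _ _ (exp_coeff `|K|)).
  - by move=> k /=.
  - by move=> k; rewrite exp_coeff_ge0.
  - move=> k; rewrite /exp_coeff/= normrM normfV normr_nat mulrC.
    rewrite ler_wpM2r ?invr_ge0// (le_trans (XK k s t))//.
    by rewrite (le_trans (ler_norm _))// normrX.
  - exact: is_cvg_series_exp_coeff.
have S_cvg : S @ \oo --> expmx X.
  rewrite /expmx -/S; apply/cvg_ex.
  exists (\matrix_(s, t) limn (series (fun k => (k`!%:R)^-1 * (X ^+ k) s t))).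
  apply: mx_cvg_entrywise => s t; rewrite SE mxE; exact: entry_cvg.
rewrite -SE.
apply: (cvg_comp S (fun M : 'M[R]_n => M i j) S_cvg).
exact: coord_continuous.
Qed.

(** As the total is 0, a partial sum is minus its tail. Since (n + 1 + k)! >= n! k!, n! times the
    tail is at most [c ^+ n.+1 * expR c]. *)
Lemma exp_tail_bounded (u : nat -> R) (c : R) :
    (forall k, `|u k| <= c ^+ k) ->
    series (fun k => u k / k`!%:R) @ \oo --> 0 ->
  egf_bounded (pser1 * pser_of_egf u).
Proof.
move=> u_le S0.
have c_ge0 : 0 <= c by have := u_le 1; rewrite expr1; apply: le_trans.
have E_ge1 : 1 <= expR c by rewrite (le_trans _ (expR_ge1Dx c))// lerDl.
have exp_le m : \sum_(k < m) c ^+ k / k`!%:R <= expR c.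
  have := @nondecreasing_cvgn_le R (series (exp_coeff c)) _ _ m.
  rewrite /series/= big_mkord; apply; last exact: is_cvg_series_exp_coeff.
  by apply: nondecreasing_series => k _ _; rewrite exp_coeff_ge0.
exists (c * expR c) => n.
rewrite /egf normrM normr_nat pcoef1M.
apply: (@le_trans _ _ (c ^+ n.+1 * expR c)); last first.
  by rewrite exprMn ler_wpM2l ?exprn_ge0// exprS ler_peMr ?expR_ge0//
    exprn_ege1.
rewrite mulrC -ler_pdivlMr ?ltr0n ?fact_gt0//.
apply/ler_addgt0Pr => eps eps_gt0.
move/cvgrPdist_lt: S0 => /(_ _ eps_gt0)[N _ SN].
have := SN (n.+1 + N)%N (leq_addl _ _).
rewrite sub0r normrN /series/= big_mkord big_split_ord/=.
(* [T] is the partial sum to bound and [W] a finite piece of the tail; [T + W] is within [eps] of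
   0. *)
set T := \sum_(i < n.+1) _; set W := \sum_(i < N) _ => lt_eps.
rewrite -[T](addrK W) (le_trans (ler_normB _ _))// addrC lerD//;
  last exact: ltW.
rewrite (le_trans (ler_norm_sum _ _ _))//.
apply: (@le_trans _ _ (c ^+ n.+1 / n`!%:R * \sum_(k < N) c ^+ k / k`!%:R)).
  rewrite mulr_sumr ler_sum// => k _.
  rewrite normrM normfV normr_nat (le_trans (ler_wpM2r _ (u_le _)))//.
  rewrite exprD mulrACA ler_wpM2l ?mulr_ge0 ?exprn_ge0//.
  rewrite -invfM lef_pV2 ?posrE ?mulr_gt0 ?ltr0n ?fact_gt0//.
  rewrite -natrM ler_nat addSnnS.
  rewrite (leq_trans _ (_ : n`! * (k.+1)`! <= _)%N)//.
    by rewrite leq_mul// factS leq_pmull.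
  rewrite -(bin_fact (leq_addr k.+1 n)) addKn leq_pmull// bin_gt0 leq_addr//.
rewrite mulrAC ler_wpM2r// ler_wpM2l ?exprn_ge0//.
Qed.

Lemma mx_powZ d (b : R) (A : 'M[R]_d) k : (b *: A) ^+ k = b ^+ k *: A ^+ k.
Proof.
elim: k => [|k IHk]; first by rewrite !expr0 scale1r.
rewrite !exprS IHk -[LHS]/(_ *m _) -scalemxAl -scalemxAr scalerA.
by [].
Qed.

End ExponentialEntries.

Lemma normalmx_rat_sym (C : numClosedFieldType) d (A : 'M[rat]_d) :
  A^T = A -> map_mx (ratr : rat -> C) A \is normalmx.
Proof.
move=> A_sym; apply/normalmxP.
suff -> : map_mx Num.conj ((map_mx (ratr :
  rat -> C) A)^T) = map_mx ratr A by [].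
by apply/matrixP => i j; rewrite -[in RHS]A_sym !mxE fmorph_rat.
Qed.

(** The differences of the two diagonal entries are integers of exponential growth, and a power sum
    by the spectral theorem; subtracting the two exponential series gives the vanishing sum. *)
Lemma expmx_diag_eq (R : realType) d (A : 'M[int]_d) (b : R) i j :
    algebraic b -> b != 0 -> A^T = A ->
    let AR := map_mx (intr : int -> R) A in
    expmx (b *: AR) i i = expmx (b *: AR) j j ->
  forall r, (AR ^+ r) i i = (AR ^+ r) j j.
Proof.
move=> b_alg b_neq0 A_sym AR exp_eq r; apply/eqP; rewrite -subr_eq0; apply/eqP.
pose A0 : 'M[rat]_d := map_mx intr A.
have DA (F : numFieldType) : map_mx (ratr : rat -> F) A0 = map_mx intr A.
  by apply/matrixP => s t; rewrite !mxE ratr_int.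
pose a r := (AR ^+ r) i i - (AR ^+ r) j j.
apply: (power_sum_egf_eq0 a b) => //.
- by move=> n; rewrite /a /AR -!map_mxX !mxE rpredB ?intr_int.
- have [K AK] := mx_pow_bounded _ AR.
  have K0 : 0 <= K by have := AK 1 i i; rewrite expr1; apply: le_trans.
  exists (K + 2) => n; rewrite (le_trans (ler_normB _ _))//.
  rewrite (le_trans (lerD (AK n i i) (AK n j j)))// -mulr2n -(mulr_natl (K ^+
    n)) exprS.
  rewrite ler_pM ?exprn_ge0//; first by rewrite lerDr.
  by rewrite lerXn2r ?nnegrE ?addr_ge0// lerDl.
- have A0_sym : A0^T = A0 by rewrite map_trmx A_sym.
  have /orthomx_spectralP DC := normalmx_rat_sym R[i] _ _ A0_sym.
  have A_sum s t : power_sum (fun n => (AR ^+ n) s t).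
    have := power_sum_mx _ A0 _ _ s t (spectral_unit _) DC.
    by rewrite DA.
  exact: power_sumB.
have [K AK] := mx_pow_bounded _ AR.
(* The bound needed has exponent [k], not [k.+1]: at 0 the difference vanishes, and for larger [k]
   the factor 2 goes into [K + K]. *)
apply: (@exp_tail_bounded _ _ ((K + K + 1) * `|b|)).
  have K0 : 0 <= K by have := AK 1 i i; rewrite expr1; apply: le_trans.
  move=> k; rewrite normrM normrX exprMn ler_wpM2r ?exprn_ge0//.
  case: k => [|k]; first by rewrite /a !expr0 !mxE !eqxx subrr normr0.
  rewrite (le_trans (ler_normB _ _))// (le_trans (lerD (AK _ i i) (AK _ j
    j)))//.
  have -> : K ^+ k.+1 + K ^+ k.+1 = (K + K) * K ^+ k by rewrite exprS mulrDl.
  rewrite exprS ler_pM ?addr_ge0 ?exprn_ge0//; first by rewrite lerDl.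
  by rewrite lerXn2r ?nnegrE ?addr_ge0// -addrA lerDl addr_ge0.
have := cvgB (expmx_entry _ (b *: AR) i i) (expmx_entry _ (b *: AR) j j).
rewrite exp_eq subrr => /(_ _) S0.
set S := series _; rewrite (_ : S = series (fun k => (k`!%:R)^-1 * ((b *:
  AR) ^+ k) i i) -
  series (fun k => (k`!%:R)^-1 * ((b *: AR) ^+ k) j j)); first exact: S0.
apply/funext => N; rewrite /S /series /= -[RHS]/(_ - _) -sumrB.
by apply: eq_bigr => k _; rewrite mx_powZ !mxE /a; ring.
Qed.

(** * Centralities *)

Section SymmetricSpectrum.
Context {R : realFieldType} {n : nat}.
Implicit Types (A S : 'M[R]_n.+1) (q : 'cV[R]_n.+1).

Lemma mul_trmx_eq0 m (W : 'M[R]_(n.+1, m)) : W^T *m W = 0 -> W = 0.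
Proof.
move=> W0; apply/matrixP => k j; rewrite [RHS]mxE.
have := congr1 (fun M : 'M[R]_m => M j j) W0; rewrite !mxE => /eqP.
rewrite psumr_eq0 => [|i _]; last by rewrite mxE -expr2 sqr_ge0.
by move=> /allP/(_ k (mem_index_enum k))/=; rewrite mxE -expr2 sqrf_eq0 => /eqP.
Qed.

(** One power of [S] is dropped at a time: for W = S^(m+1) V, symmetry gives W^T W = (S^m V)^T
    S^(m+2) V = 0. *)
Lemma symmx_exp_ker S m (V : 'M[R]_n.+1) :
  S^T = S -> S ^+ m * V = 0 -> S * V = 0.
Proof.
move=> S_sym; case: m => [|m]; first by rewrite mul1r => ->; rewrite mulr0.
elim: m => // m IHm SV; apply: IHm; rewrite exprS -mulrA.
apply: mul_trmx_eq0; rewrite trmx_mul S_sym -mulmxA -!mulmxE in SV *.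
by rewrite [S *m (S *m _)](_ : _ = 0) ?mulmx0// -SV !exprS -!mulmxE !mulmxA.
Qed.

Lemma horner_mx_diag_eq A i j (p : {poly R}) :
  (forall r, (A ^+ r) i i = (A ^+ r) j j) ->
  horner_mx A p i i = horner_mx A p j j.
Proof.
move=> Aij; rewrite -[p]coefK poly_def !rmorph_sum/= !summxE.
apply: eq_bigr => k _.
by rewrite linearZ/= rmorphXn/= horner_mx_X !mxE Aij.
Qed.

Lemma horner_mx_left_eigen A (w : 'rV[R]_n.+1) lam (p : {poly R}) :
  w *m A = lam *: w -> w *m horner_mx A p = p.[lam] *: w.
Proof.
move=> wA; elim/poly_ind: p => [|p c IHp];
  first by rewrite rmorph0 mulmx0 horner0 scale0r.
rewrite rmorphD rmorphM/= horner_mx_X horner_mx_C mulmxDr -mulmxE mulmxA IHp.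
by rewrite -scalemxAl wA mul_mx_scalar hornerMXaddC scalerA -scalerDl.
Qed.

(* If [char_poly A = g * ('X - lam%:P) ^+ m] with [g.[lam] != 0], then the
   columns of [g(A)] are eigenvectors, so [g(A) = g.[lam] *: (q *m q^T)]. *)
Lemma simple_eigenvector_sqr A q lam i j :
    A^T = A -> A *m q = lam *: q -> \sum_k q k 0 ^+ 2 = 1 ->
    (forall x : 'cV[R]_n.+1, A *m x = lam *: x -> exists t, x = t *: q) ->
    (forall r, (A ^+ r) i i = (A ^+ r) j j) ->
  q i 0 ^+ 2 = q j 0 ^+ 2.
Proof.
move=> A_sym Aq q1 simple Aij.
have [m [g]] := multiplicity_XsubC (char_poly A) lam.
rewrite monic_neq0 ?char_poly_monic//= => g_lam Dchar.
pose H := horner_mx A g.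
(* Cayley-Hamilton gives this with [A - lam%:M] to the power [m]; symmetry reduces the power to
   one. *)
have SH : (A - lam%:M) *m H = 0.
  apply: (@symmx_exp_ker _ m); first by rewrite linearB/= tr_scalar_mx A_sym.
  have := Cayley_Hamilton A; rewrite Dchar mulrC rmorphM rmorphXn rmorphB/=.
  by rewrite horner_mx_X horner_mx_C.
have /choice[y Hy] : forall k, exists t, col k H = t *: q.
  move=> k; apply: simple; apply/eqP; rewrite -subr_eq0 -mul_scalar_mx -mulmxBl.
  by rewrite colE mulmxA SH mul0mx.
have DH : H = q *m \row_k y k.
  apply/matrixP => s k; have /colP/(_ s) := Hy k; rewrite !mxE => ->.
  by rewrite big_ord1 !mxE mulrC.
have qq : q^T *m q = 1%:M.
  apply/matrixP => s t; rewrite !ord1 !mxE -q1.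
  by rewrite eqxx; apply: eq_bigr => k _; rewrite mxE expr2.
(* Multiply [H] on the left by [q^T], a left eigenvector of [A] of unit norm. *)
have Dy : \row_k y k = g.[lam] *: q^T.
  rewrite -[LHS]mul1mx -qq -mulmxA -DH; apply: horner_mx_left_eigen.
  by rewrite -{1}A_sym -trmx_mul Aq linearZ.
have HE k : H k k = g.[lam] * q k 0 ^+ 2.
  by rewrite DH Dy !mxE big_ord1 !mxE expr2 mulrCA.
have := horner_mx_diag_eq _ _ _ g Aij; rewrite -/H !HE.
by apply: mulfI.
Qed.

End SymmetricSpectrum.

(** * Adjacency matrices of connected simple graphs *)

Section Adjacency.
Context {R : realType} {n : nat} (e : rel 'I_n).
Hypotheses (e_simple : simple_graph e) (e_conn : connected_graph e).
Local Notation A := (adjmx R e).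

Lemma adjmx_sym : A^T = A.
Proof. by apply/matrixP => i j; rewrite !mxE (e_simple.1 i j). Qed.

(** Both sides count the neighbours of [i]: without loops, [k] is determined by the edge joining it
    to [i]. *)
Lemma degree_centrality_adjmx i : (degree_centrality e i)%:R = (A ^+ 2) i i.
Proof.
have [e_sym e_irr] := e_simple.
have -> : (A ^+ 2) i i = #|[set k | e i k]%SET|%:R.
  rewrite mx_exprSE -sum1_card natr_sum [RHS]big_mkcond/=.
  apply: eq_bigr => k _; rewrite expr1 !mxE (e_sym k i) finset.in_set.
  by case: (e i k); rewrite ?mulr1 ?mul0r.
rewrite /degree_centrality; congr (_%:R).
rewrite -(@card_in_imset _ _ (fun k => [set i; k]%SET)); last first.
  move=> k l; rewrite !finset.in_set => ik il /setP/(_ k).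
  rewrite !finset.in_set2 eqxx orbT => /esym/orP[/eqP ki|/eqP//].
  by move: ik; rewrite ki e_irr.
congr #|pred_of_set _|; apply/finset.setP => E; rewrite finset.in_set.
apply/andP/imsetP => [[/imsetP[[k l] /= kl ->]]|[k]].
  have {}kl : e k l := kl.
  rewrite finset.in_set2 => /orP[/eqP ik|/eqP il].
    by exists l; rewrite ik// finset.in_set.
  exists k; rewrite il; first by rewrite finset.in_set e_sym.
  exact: finset.setUC.
rewrite finset.in_set => ik ->; split; last by rewrite finset.in_set2 eqxx.
by apply/imsetP; exists (i, k).
Qed.

(** At a zero entry the eigenvalue equation makes a sum of nonnegative neighbouring entries vanish,
    so zeros spread along edges. *)
Lemma eigenvector_zero_entry (y : 'cV[R]_n) lam i0 :
    A *m y = lam *: y -> (forall i, 0 <= y i 0) -> y i0 0 = 0 ->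
  forall i, y i 0 = 0.
Proof.
move=> Ay y_ge0 y0.
have step i k : e i k -> y i 0 = 0 -> y k 0 = 0.
  move=> ik yi; have := congr1 (fun M : 'cV[R]_n => M i 0) Ay.
  rewrite [in RHS]mxE yi mulr0 mxE => /eqP.
  rewrite psumr_eq0 => [|l _]; last by rewrite mulr_ge0// mxE.
  by move=> /allP/(_ k (mem_index_enum k))/=; rewrite mxE ik mul1r => /eqP.
have closed0 : fingraph.closed e [pred i | y i 0 == 0].
  move=> i k ik; rewrite !inE; apply/eqP/eqP; first exact: step.
  by apply: step; rewrite e_simple.1.
move=> i; apply/eqP.
have := closed_connect closed0 (e_conn i0 i).
by rewrite !inE y0 eqxx => /esym.
Qed.

(* Subtracting from [x] the largest [t *: q] below it creates a zero entry. *)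
Lemma nonneg_eigenvector_simple (q x : 'cV[R]_n) lam :
    A *m q = lam *: q -> (forall i, 0 <= q i 0) -> q != 0 ->
    A *m x = lam *: x ->
  exists t, x = t *: q.
Proof.
move=> Aq q_ge0 q_neq0 Ax.
have q_gt0 i : 0 < q i 0.
  rewrite lt_neqAle q_ge0 andbT eq_sym; apply: contraNneq q_neq0 => qi0.
  apply/eqP/colP => k; rewrite mxE.
  exact: eigenvector_zero_entry Aq q_ge0 qi0 k.
have [i0 _] : exists i0 : 'I_n, true.
  have /cV0Pn[i0 _] := q_neq0; by exists i0.
case: (@arg_minP _ _ _ i0 xpredT (fun i => x i 0 / q i 0)) => // i1 _ i1_min.
exists (x i1 0 / q i1 0); set t := _ / _.
apply/eqP; rewrite -subr_eq0; apply/eqP/colP => k; rewrite [RHS]mxE.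
apply: (@eigenvector_zero_entry _ lam i1).
- by rewrite mulmxBr -scalemxAr Ax Aq scalerBr !scalerA [t * _]mulrC.
- by move=> i; rewrite !mxE subr_ge0 -ler_pdivlMr// i1_min.
- by rewrite !mxE /t divfK ?subrr// gt_eqF.
Qed.

End Adjacency.

(** [nonneg_eigenvector_simple] supplies the simplicity needed to compare squares; nonnegativity of
    [q] removes the squares. *)
Lemma eigenvector_centralities_eq (R : realType) n (e : rel 'I_n)
    (q : 'cV[R]_n) i j :
    simple_graph e -> connected_graph e ->
    eigenvector_centralities (adjmx R e) q ->
    (forall r, (adjmx R e ^+ r) i i = (adjmx R e ^+ r) j j) ->
  q i 0 = q j 0.
Proof.
case: n => [|n] in e q i j *; first by case: i.
move=> e_simple e_conn [lam [_ Aq q_ge0 q1]] Aij.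
have q_neq0 : q != 0.
  apply: contra_eq_neq q1 => ->; rewrite big1 ?(eq_sym 0) ?oner_eq0// => k _.
  by rewrite mxE expr0n.
apply/eqP; rewrite -(eqrXn2 (_ : 0 < 2)%N)//; apply/eqP.
apply: (simple_eigenvector_sqr _ _ _ _ _ (adjmx_sym e e_simple) Aq) => // x.
exact: nonneg_eigenvector_simple.
Qed.

Theorem theorem4p2 (R : realType) (beta : R) (n : nat) (e : rel 'I_n)
    (beta_gt0 : 0 < beta) (beta_alg : algebraic beta)
    (e_simple : simple_graph e) (e_conn : connected_graph e) :
  let A := adjmx R e in
  let expA := expmx (beta *: A) in
  [/\ (forall i j : 'I_n, expA i i = expA j j) <-> walk_regular A,
      (forall i j : 'I_n, expA i i = expA j j ->
         degree_centrality e i = degree_centrality e j /\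
         (forall q : 'cV[R]_n, eigenvector_centralities A q ->
            q i 0 = q j 0))
    & (forall i j : 'I_n, expA i i = expA j j) ->
      (forall i j : 'I_n, degree_centrality e i = degree_centrality e j) /\
      (forall q : 'cV[R]_n, eigenvector_centralities A q ->
         forall i j : 'I_n, q i 0 = q j 0)].
Proof.
move=> A expA.
have powers_eq i j : expA i i = expA j j -> forall r, (A ^+ r) i i = (A ^+ r)
  j j.
  have DA : A = map_mx intr (\matrix_(s, t) (e s t)%:R : 'M[int]_n).
    by apply/matrixP => s t; rewrite !mxE rmorph_nat.
  rewrite /expA DA; apply: expmx_diag_eq => //; first exact: lt0r_neq0.
  by apply/matrixP => s t; rewrite !mxE (e_simple.1 s t).
have centralities_eq i j : expA i i = expA j j ->
    degree_centrality e i = degree_centrality e j /\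
    (forall q : 'cV[R]_n, eigenvector_centralities A q -> q i 0 = q j 0).
  move=> /powers_eq Aij; split=> [|q Aq].
    by apply/eqP; rewrite -(eqr_nat R) !degree_centrality_adjmx// Aij.
  exact: (eigenvector_centralities_eq _ _ _ _ _ _ e_simple e_conn Aq).
split=> //; last first.
  move=> exp_eq; split=> [i j|q Aq i j].
    exact: (centralities_eq i j (exp_eq i j)).1.
  exact: (centralities_eq i j (exp_eq i j)).2.
split=> [exp_eq i j r _|walk i j]; first exact: powers_eq.
rewrite /expA -(cvg_lim _ (expmx_entry _ _ i i))// -(cvg_lim _ (expmx_entry _
  _ j j))//.
(* Walk-regularity starts at exponent 1; at exponent 0 both entries are diagonal entries of the
   identity. *)
congr (limn (series _)); apply/funext => k; congr (_ * _).
rewrite mx_powZ !mxE; congr (_ * _); case: k => [|k]; last exact: walk.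
by rewrite !expr0 !mxE !eqxx.
Qed.
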